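(* Let $N\ge2$. For any $k\in\mathbb{N}$ there exist a family of smooth and bounded domains $\Omega_\varepsilon\subseteq\mathbb{R}^{N+1}$ and smooth positive functions $u_\varepsilon:\Omega_\varepsilon\to\mathbb{R}$ (indexed by small $\varepsilon>0$) such that (i) $\Omega_\varepsilon$ is starshaped with respect to an interior point; (ii) $\Omega_\varepsilon$ locally converges to the cylinder $\mathcal C=\{(x,y)\in\mathbb{R}\times\mathbb{R}^N : |y|^2<1\}$ as $\varepsilon\to0$, i.e. for every compact set $K\subseteq\mathbb{R}^{N+1}$ one has $|K\cap(\mathcal C\,\Delta\,\Omega_\varepsilon)|\to0$ as $\varepsilon\to0$; (iii) the mean curvature of $\partial\Omega_\varepsilon$ is positive; (iv) $u_\varepsilon$ solves the torsion problem $-\Delta u=1$ in $\Omega_\varepsilon$, $u=0$ on $\partial\Omega_\varepsilon$; (v) $u_\varepsilon$ has at least $k$ nondegenerate (local) maximum points.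
   Context: $\Delta$ between sets denotes symmetric difference and $|\cdot|$ of a set denotes Lebesgue measure. The mean curvature of $\partial\Omega_\varepsilon$ is the average of the principal curvatures, with the sign convention that it is positive for round spheres (boundaries of balls), i.e. $\frac1N\mathrm{tr}(d\mathbf N)$ with $\mathbf N$ the outward unit normal. A critical point is nondegenerate if the Hessian there is invertible. *)

(* Defs.v *)
From HB Require Import structures.
From mathcomp Require Import all_boot all_order all_algebra.
From mathcomp Require Import all_classical all_reals all_analysis.
Set Implicit Arguments.
Unset Strict Implicit.
Unset Printing Implicit Defensive.
Import Order.TTheory GRing.Theory Num.Theory.
Import numFieldNormedType.Exports.
Local Open Scope classical_set_scope.
Local Open Scope ring_scope.

Section euclidean.
Variables (R : realType) (n : nat).
Implicit Types (u v x : 'rV[R]_n) (f : 'rV[R]_n -> R) (U : set 'rV[R]_n).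

(* The library norm on ['rV[R]_n] is the sup norm: it induces the usual
   topology and bounded sets, but lengths have to be taken with [enorm]. *)
Definition dotr u v : R := \sum_(i < n) u 0 i * v 0 i.
Definition enorm u : R := Num.sqrt (dotr u u).

Definition partial (i : 'I_n) f x : R := 'D_('e_i) f x.
Definition gradient f x : 'rV[R]_n := \row_i partial i f x.
Definition hessian f x : 'M[R]_n := \matrix_(i, j) partial i (partial j f) x.
Definition laplacian f x : R := \tr (hessian f x).

(* Meant for open [U]. *)
Fixpoint Ck_on (k : nat) U f : Prop :=
  (forall x, U x -> {for x, continuous f}) /\
  match k with
  | 0 => True
  | k'.+1 => forall i : 'I_n,
      (forall x, U x -> derivable f x 'e_i) /\ Ck_on k' U (partial i f)
  end.
Definition smooth_on U f : Prop := forall k, Ck_on k U f.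

Definition is_local_max f x : Prop := \forall y \near x, f y <= f x.
Definition nondegenerate_critical_point f x : Prop :=
  gradient f x = 0 /\ hessian f x \in unitmx.

Definition starshaped_interior U : Prop :=
  exists2 p, U° p &
    forall q (t : R), U q -> 0 <= t <= 1 -> U (p + t *: (q - p)).

End euclidean.

Section hypersurface.
Variables (R : realType) (n : nat).
Implicit Types (p q nu : 'rV[R]_n) (Omega U : set 'rV[R]_n).

Definition frontier Omega : set 'rV[R]_n := closure Omega `\` Omega°.

Definition local_defining_function Omega p (psi : 'rV[R]_n -> R) : Prop :=
  exists U, [/\ open U, U p, smooth_on U psi,
    (forall x, U x -> gradient psi x != 0) &
    (forall x, U x -> (Omega x <-> psi x < 0))].

Definition smooth_domain Omega : Prop :=
  [/\ open Omega, Omega !=set0, connected Omega &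
    forall p, frontier Omega p ->
      exists psi, local_defining_function Omega p psi].

(* Does not depend on the choice of [psi]. *)
Definition is_outward_unit_normal Omega p nu : Prop :=
  exists2 psi, local_defining_function Omega p psi &
    nu = (enorm (gradient psi p))^-1 *: gradient psi p.

Definition is_gauss_map Omega (G : 'rV[R]_n -> 'rV[R]_n) : Prop :=
  forall q, frontier Omega q -> is_outward_unit_normal Omega q (G q).

(* [L], acting on row vectors by right multiplication, is the differential at
   [p] of [G] as a map defined on the hypersurface only, extended by 0 to the
   normal line; this determines [L], and \tr L = tr (dG_p). *)
Definition is_gauss_differential Omega (G : 'rV[R]_n -> 'rV[R]_n) p
    (L : 'M[R]_n) : Prop :=
  (forall e : R, 0 < e -> \forall q \near within (frontier Omega) (nbhs p),
    `|G q - G p - (q - p) *m L| <= e * `|q - p|) /\ G p *m L = 0.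

(* For [n] = N + 1, the hypersurface has N principal curvatures. *)
Definition is_mean_curvature Omega p (H : R) : Prop :=
  exists G L, [/\ is_gauss_map Omega G, is_gauss_differential Omega G p L &
    H = (n.-1)%:R^-1 * \tr L].

End hypersurface.

Section lebesgue.
Variable R : realType.

Definition consr (n : nat)
    (z : n.-tuple (measurableTypeR R) * measurableTypeR R) :
  n.+1.-tuple (measurableTypeR R) := [tuple of z.2 :: z.1].

Lemma measurable_consr n : measurable_fun [set: _] (@consr n).
Proof. exact: (measurable_cons measurable_snd measurable_fst). Qed.

(* n-fold product of the one-dimensional Lebesgue measure. *)
Fixpoint lebesgue_tuple (n : nat) :
    {measure set (n.-tuple (measurableTypeR R)) -> \bar R} :=
  match n with
  | 0 => \d_[tuple]
  | n'.+1 => measure_function_pushforward__canonical__measure_function_Measure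
       (lebesgue_tuple n' \x lebesgue_measure)%E (@measurable_consr n')
  end.

Definition lebesgue_rV (n : nat) (A : set 'rV[R]_n) : \bar R :=
  lebesgue_tuple n [set t | A (\row_i tnth t i)].

End lebesgue.

Section torsion.
Variables (R : realType) (n : nat).
Implicit Types (Omega : set 'rV[R]_n) (u : 'rV[R]_n -> R).

(* A function on [Omega] is represented by any total extension; only the values
   on the closure of [Omega] matter. *)
Definition torsion_solution Omega u : Prop :=
  [/\ {within closure Omega, continuous u},
    (forall x, Omega x -> - laplacian u x = 1) &
    (forall x, frontier Omega x -> u x = 0)].

End torsion.

(* Coordinate 0 is the axial variable x, coordinates 1, ..., N form y. *)
Definition cylinder (R : realType) (N : nat) : set 'rV[R]_N.+1 :=
  [set v | \sum_(i < N) v 0 (lift ord0 i) ^+ 2 < 1].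
Arguments cylinder R N : clear implicits.

(* Main.v *)
Require Import Defs.
From HB Require Import structures.
From mathcomp Require Import all_boot all_order all_algebra.
From mathcomp Require Import all_classical all_reals all_analysis.
From mathcomp Require Import ring lra measurable_realfun.
Set Implicit Arguments.
Unset Strict Implicit.
Unset Printing Implicit Defensive.
Import Order.TTheory GRing.Theory Num.Theory.
Import numFieldNormedType.Exports.
Local Open Scope classical_set_scope.
Local Open Scope ring_scope.

(** The torsion function of the cylinder is [(1 - |y|^2) / (2 N)]. Any harmonic
    perturbation of it still satisfies [- laplacian u = 1], so it is the torsion
    function of the set where it is positive, and only the geometry of that set
    has to be controlled. With [x] the axial coordinate and [y1] one of the
    transversal ones, the perturbation taken here is
      [u = (1 - |y|^2) / (2 N) - e (beta (x^2 - y1^2) - cos x cosh y1)].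
    Both [x^2 - y1^2] and [cos x cosh y1] are harmonic. Since [cosh] eventually
    beats [y1^2], the domain is [{u > 0}] inside the slab [|y1| < 2]; on the
    closed slab, [u >= 0] forces [|y|^2 <= 9/8], so the truncation is invisible
    on the boundary ([torsion_domain_slab]). The quadratic term makes the domain
    bounded, a slightly perturbed ellipsoid of length of order [e^(-1/2)], on
    which [e |x|] is still small ([torsion_domain_axial_bound]).

    - Maxima. On the axis [u] is [1 / (2 N) - e (beta x^2 - cos x)]. For [beta]
      small, depending on [k] only, [beta x^2 - cos x] has at least [k] local
      minima where the cosine is positive ([tilted_cosine_wells]). Across the
      axis the term [- |y|^2 / (2 N)] dominates, so these are nondegenerate
      local maxima of [u].
    - Starshapedness. The function [(1 - |y|^2) / (2 N) - e beta (x^2 - y1^2)]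
      is a constant plus a homogeneous function of degree 2, so
      [u (t p) - t^2 u p] is [(1 - t^2) / (2 N)] up to an error of order
      [e (1 + |x|) (1 - t^2)] ([torsion_fun_homothety]). Differentiating in the
      radial direction, the same computation shows that the gradient does not
      vanish on the boundary ([gradient_torsion_fun_neq0]).
    - Mean curvature. For a level set of [psi = - u] it has the sign of
      [|grad u|^2 + D^2 u (grad u, grad u)], because [laplacian u = -1]
      ([mean_curvature_gt0]). The Hessian of [u] is at least [- (1/N + small)],
      and [1 - 1/N] is positive exactly because [N >= 2].
    - Convergence. On a compact set, a point that belongs to just one of the
      cylinder and the domain satisfies [| 1 - |y|^2 | <= C e]; the part of such
      a shell in a box has measure of order [sqrt e] by Fubini
      ([lebesgue_cylindrical_shell_le]). *)

(** * Elementary functions of several variables *)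

Section elementary.
Variables (R : realType).

Definition cosh (x : R) : R := (expR x + expR (- x)) / 2.
Definition sinh (x : R) : R := (expR x - expR (- x)) / 2.

Lemma is_derive_cosh (x : R) : is_derive x 1 cosh (sinh x).
Proof.
have h : is_derive x 1 (2^-1 *: (@expR R + (@expR R \o -%R)))
  (2^-1 *: (expR x + - expR (- x))).
  apply: is_deriveZ; apply: is_deriveD.
  have := is_derive1_comp (is_derive_expR (- x)) (is_deriveNid x 1).
  by rewrite mulrN1.
rewrite (_ : cosh = 2^-1 *: (@expR R + (@expR R \o -%R))).
  by apply: is_derive_eq; rewrite /sinh mulrC.
by apply/funext => y; rewrite /cosh mulrC.
Qed.

Lemma is_derive_sinh (x : R) : is_derive x 1 sinh (cosh x).
Proof.
have h : is_derive x 1 (2^-1 *: (@expR R - (@expR R \o -%R)))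
  (2^-1 *: (expR x - - expR (- x))).
  apply: is_deriveZ; apply: is_deriveB.
  have := is_derive1_comp (is_derive_expR (- x)) (is_deriveNid x 1).
  by rewrite mulrN1.
rewrite (_ : sinh = 2^-1 *: (@expR R - (@expR R \o -%R))).
  by apply: is_derive_eq; rewrite /cosh mulrC opprK.
by apply/funext => y; rewrite /sinh mulrC.
Qed.

Variable n : nat.
Local Notation V := 'rV[R]_n.

Lemma chain_rule (f : V -> R) (g : R -> R) (dg : R) (x v : V) :
  differentiable f x -> is_derive (f x) 1 g dg ->
  differentiable (g \o f) x /\ 'D_v (g \o f) x = dg * 'D_v f x.
Proof.
move=> df [dg1 dg2].
have dg' : differentiable g (f x) by apply/derivable1_diffP.
split; first exact: differentiable_comp.
rewrite deriveE; last exact: differentiable_comp.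
rewrite diff_comp // deriveE // /=.
by rewrite (deriv1E dg1) derive1E dg2 /= mulrC.
Qed.

Lemma derive_coord (i : 'I_n) (x v : V) :
  'D_v (fun y : V => y 0 i) x = v 0 i.
Proof.
have /= := @derive_mx R V 1 n id x v (@derivable_id _ _ x v).
by rewrite derive_id => /matrixP/(_ 0 i) ->; rewrite mxE.
Qed.

(** Elementary expressions are closed under partial derivatives, which can be
    computed symbolically; every function denoted by one is therefore smooth,
    and its Hessian is obtained by computation. *)
Inductive expr :=
| Cst of R
| Var of 'I_n
| Add of expr & expr
| Mul of expr & expr
| Sum m of 'I_m -> expr
| Cos of expr
| Sin of expr
| Cosh of expr
| Sinh of expr.

Fixpoint eval (t : expr) (x : V) : R :=
  match t with
  | Cst c => c
  | Var i => x 0 i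
  | Add t1 t2 => eval t1 x + eval t2 x
  | Mul t1 t2 => eval t1 x * eval t2 x
  | Sum m f => \sum_(i < m) eval (f i) x
  | Cos t => cos (eval t x)
  | Sin t => sin (eval t x)
  | Cosh t => cosh (eval t x)
  | Sinh t => sinh (eval t x)
  end.

Fixpoint der (j : 'I_n) (t : expr) : expr :=
  match t with
  | Cst c => Cst 0
  | Var i => Cst (i == j)%:R
  | Add t1 t2 => Add (der j t1) (der j t2)
  | Mul t1 t2 => Add (Mul (der j t1) t2) (Mul t1 (der j t2))
  | Sum m f => Sum (fun i => der j (f i))
  | Cos t => Mul (Mul (Cst (-1)) (Sin t)) (der j t)
  | Sin t => Mul (Cos t) (der j t)
  | Cosh t => Mul (Sinh t) (der j t)
  | Sinh t => Mul (Cosh t) (der j t)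
  end.

Lemma differentiable_eval (t : expr) (x : V) : differentiable (eval t) x.
Proof.
elim: t => /= [c|i|t1 h1 t2 h2|t1 h1 t2 h2|m f hf|t h|t h|t h|t h].
- exact: differentiable_cst.
- exact: differentiable_coord.
- exact: differentiableD.
- exact: differentiableM.
- rewrite (_ : (fun _ => _) = \sum_(i < m) eval (f i)).
    exact: differentiable_sum.
  by apply/funext => y; rewrite fct_sumE.
- by have [] := chain_rule 0 h (is_derive_cos _).
- by have [] := chain_rule 0 h (is_derive_sin _).
- by have [] := chain_rule 0 h (is_derive_cosh _).
- by have [] := chain_rule 0 h (is_derive_sinh _).
Qed.

Lemma partial_eval (j : 'I_n) (t : expr) :
  partial j (eval t) = eval (der j t).
Proof.
apply/funext => x; rewrite /partial.
have dv t' v : derivable (eval t') x v.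
  exact/diff_derivable/differentiable_eval.
elim: t => /= [c|i|t1 h1 t2 h2|t1 h1 t2 h2|m f hf|t h|t h|t h|t h].
- exact: derive_cst.
- by rewrite derive_coord mxE eqxx.
- by rewrite -h1 -h2 -deriveD.
- rewrite -h1 -h2 deriveM //= addrC /GRing.scale /=; congr (_ + _).
  by rewrite mulrC.
- rewrite (_ : (fun _ => _) = \sum_(i < m) eval (f i)).
    rewrite derive_sum; last by move=> i; exact: dv.
    by apply: eq_bigr => i _.
  by apply/funext => y; rewrite fct_sumE.
- have [_ ->] := chain_rule 'e_j (differentiable_eval t x) (is_derive_cos _).
  by rewrite h mulN1r.
- have [_ ->] := chain_rule 'e_j (differentiable_eval t x) (is_derive_sin _).
  by rewrite h.
- have [_ ->] := chain_rule 'e_j (differentiable_eval t x) (is_derive_cosh _).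
  by rewrite h.
- have [_ ->] := chain_rule 'e_j (differentiable_eval t x) (is_derive_sinh _).
  by rewrite h.
Qed.

Lemma continuous_eval (t : expr) : continuous (eval t).
Proof. by move=> x; exact/differentiable_continuous/differentiable_eval. Qed.

(** A partial derivative is again the value of an expression, so the induction is
    on the order of differentiability alone. *)
Lemma smooth_eval (U : set V) (t : expr) : smooth_on U (eval t).
Proof.
move=> k; elim: k t => [|k IH] t /=.
  by split=> // x _; exact: continuous_eval.
split=> [x _|i]; first exact: continuous_eval.
split; last by rewrite partial_eval; exact: IH.
by move=> x _; exact/diff_derivable/differentiable_eval.
Qed.

End elementary.

(** * One-variable estimates and the wells of a tilted cosine *)

Section one_variable.
Variable R : realType.
Implicit Types x y : R.

Lemma cos_lipschitz x y : `|cos x - cos y| <= `|x - y|.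
Proof.
wlog xy : x y / x <= y => [h|].
  by case: (leP x y) => [|/ltW] /h //; rewrite distrC [`|y - _|]distrC.
have [z _] := MVT_segment xy (fun z _ => is_derive_cos z)
  (continuous_subspaceT (@continuous_cos R)).
rewrite distrC => ->; rewrite normrM normrN [`|x - y|]distrC.
by rewrite ler_piMl // sin_max.
Qed.

Lemma cosh_le y (b : R) : `|y| <= b -> cosh y <= expR b.
Proof.
rewrite ler_norml => /andP[h1 h2].
have : expR y <= expR b by rewrite ler_expR.
have : expR (- y) <= expR b by rewrite ler_expR lerNl.
by rewrite /cosh; lra.
Qed.

Lemma cosh_ge1 y : 1 <= cosh y.
Proof.
have := expR_ge1Dx y; have := expR_ge1Dx (- y).
by rewrite /cosh; lra.
Qed.

Lemma sinh_le y (b : R) : `|y| <= b -> `|sinh y| <= expR b.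
Proof.
move=> h; apply: le_trans (cosh_le h); rewrite /cosh /sinh.
have := expR_gt0 y; have := expR_gt0 (- y).
by rewrite ler_norml; lra.
Qed.

Lemma expR_lipschitz x y (b : R) : x <= b -> y <= b ->
  `|expR x - expR y| <= expR b * `|x - y|.
Proof.
wlog xy : x y / x <= y => [h|xb yb].
  by case: (leP x y) => [|/ltW] /h //; rewrite distrC [`|y - _|]distrC; auto.
rewrite distrC [`|x - y|]distrC !ger0_norm ?subr_ge0 ?ler_expR //.
have := expR_ge1Dx (x - y); have -> : expR x = expR y * expR (x - y).
  by rewrite -expRD addrC subrK.
have : expR y <= expR b by rewrite ler_expR.
have := expR_gt0 y; nra.
Qed.

Lemma cosh_lipschitz x y (b : R) : `|x| <= b -> `|y| <= b ->
  `|cosh x - cosh y| <= expR b * `|x - y|.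
Proof.
move=> /[!ler_norml] /andP[x1 x2] /andP[y1 y2].
have h1 := expR_lipschitz x2 y2.
have h2 : `|expR (- x) - expR (- y)| <= expR b * `|x - y|.
  rewrite (_ : `|x - y| = `|- x - - y|); last by rewrite -opprD normrN.
  by apply: expR_lipschitz; rewrite lerNl.
have -> : cosh x - cosh y =
  ((expR x - expR y) + (expR (- x) - expR (- y))) / 2 by rewrite /cosh; lra.
by move: h1 h2; rewrite !ler_norml; lra.
Qed.

(** [cosh y - 1] is half the square of [exp (y / 2) - exp (- y / 2)], to which
    the Lipschitz estimate applies. *)
Lemma cosh_sub1_le y (b : R) : `|y| <= b -> cosh y - 1 <= expR b * y ^+ 2.
Proof.
move=> yb.
have h : `|expR (y / 2) - expR (- (y / 2))| <= expR (b / 2) * `|y|.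
  have /andP[h1 h2] : - b <= y <= b by rewrite -ler_norml.
  have := @expR_lipschitz (y / 2) (- (y / 2)) (b / 2).
  by rewrite (_ : y / 2 - - (y / 2) = y); [apply; lra|lra].
have -> : cosh y - 1 = (expR (y / 2) - expR (- (y / 2))) ^+ 2 / 2.
  have half (z : R) : expR z = expR (z / 2) ^+ 2.
    by rewrite expr2 -expRD; congr expR; lra.
  have : expR (y / 2) * expR (- (y / 2)) = 1 by rewrite -expRD subrr expR0.
  rewrite /cosh (half y) (half (- y)) mulNr => AB.
  by rewrite sqrrB AB; lra.
have -> : expR b * y ^+ 2 = (expR (b / 2) * `|y|) ^+ 2.
  rewrite exprMn real_normK ?num_real //; congr (_ * _).
  by rewrite expr2 -expRD; congr expR; lra.
rewrite -[X in X / 2]real_normK ?num_real //.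
have : 0 <= `|expR (y / 2) - expR (- (y / 2))| by [].
nra.
Qed.

Lemma cosD2pin x m : cos (x + pi *+ 2 *+ m) = cos x.
Proof. by rewrite (periodicn (@cosD2pi R)). Qed.

(** The tilted cosine [beta x^2 - cos x] is nonnegative where the cosine
    vanishes, but negative at the first [k] multiples of [2 pi] as soon as
    [beta] is small; so each of the intervals of half-width [pi / 2] around
    them has an interior minimum. *)
Lemma tilted_cosine_wells (k : nat) : exists2 beta : R, 0 < beta &
  exists2 xs : 'I_k -> R, injective xs & forall i,
    [/\ 0 < cos (xs i), 2 * beta * xs i + sin (xs i) = 0,
     beta * xs i ^+ 2 - cos (xs i) < 0 &
     \forall x \near xs i,
       beta * xs i ^+ 2 - cos (xs i) <= beta * x ^+ 2 - cos x].
Proof.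
(* This makes [beta (2 pi i)^2 = (i / (k + 1))^2 < 1] for [i < k]. *)
pose beta : R := (pi *+ 2 *+ k.+1) ^- 2.
have pi2 := pi_gt0 R.
have beta0 : 0 < beta by rewrite invr_gt0 exprn_gt0 // pmulrn_lgt0 // pmulrn_lgt0.
exists beta => //.
pose m (i : 'I_k) : R := pi *+ 2 *+ i.
pose f x : R := beta * x ^+ 2 - cos x.
have df x : is_derive x 1 f (2 * beta * x + sin x).
  rewrite (_ : f = beta *: (@id R) ^+ 2 - @cos R); last first.
    by apply/funext => y.
  by apply: is_derive_eq; rewrite /GRing.scale /=; lra.
have cf : continuous f.
  move=> x; apply: differentiable_continuous; apply/derivable1_diffP.
  by have [] := df x.
have ex i : exists c : R, [/\ m i - pi / 2 < c < m i + pi / 2,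
    2 * beta * c + sin c = 0, f c < 0 & \forall x \near c, f c <= f x].
  have le_ : m i - pi / 2 <= m i + pi / 2 by lra.
  have [c cin cmin] := EVT_min le_ (continuous_subspaceT cf).
  have cm : cos (m i) = 1 by rewrite -[m i]add0r cosD2pin cos0.
  have fm : f (m i) < 0.
    rewrite /f cm subr_lt0 /beta mulrC -exprVn -exprMn.
    rewrite expr_lt1 //; last first.
      by rewrite divr_ge0 // mulrn_wge0 // mulrn_wge0 // ltW.
    rewrite ltr_pdivrMr ?mul1r; last by rewrite pmulrn_lgt0 // pmulrn_lgt0.
    by rewrite ltr_pMn2l ?ltnS ?(ltnW (ltn_ord i)) // pmulrn_lgt0.
  have fc : f c < 0.
    by apply: le_lt_trans fm; apply: cmin; rewrite in_itv /=; lra.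
  have fend x : cos x = 0 -> 0 <= f x.
    by move=> x0; rewrite /f x0 subr0 mulr_ge0 ?sqr_ge0 // ltW.
  have e1 : cos (m i - pi / 2) = 0.
    by rewrite addrC cosD2pin cosN cos_pihalf.
  have e2 : cos (m i + pi / 2) = 0 by rewrite addrC cosD2pin cos_pihalf.
  have cin' : m i - pi / 2 < c < m i + pi / 2.
    move: cin; rewrite in_itv /= !le_eqVlt => /andP[/predU1P[cE|->] /predU1P[cE'|->]] //.
    - by have := fend _ e1; rewrite cE; lra.
    - by have := fend _ e1; rewrite cE; lra.
    - by have := fend _ e2; rewrite -cE'; lra.
  exists c; split => //.
    have dc : is_derive c 1 f 0.
      apply: (derive1_at_min le_) => [t _| |t tin].
      - by have [] := df t.
      - by rewrite in_itv /=.
      - by apply: cmin; exact: subset_itv_oo_cc tin.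
    by have [_ <-] := df c; have [_ ->] := dc.
  have cin2 : c \in `]m i - pi / 2, m i + pi / 2[ by rewrite in_itv /=.
  apply: filterS (near_in_itvoo cin2) => x xin.
  by apply: cmin; exact: subset_itv_oo_cc xin.
have [xs hxs] := choice ex; exists xs.
  move=> i j eq_ij; apply/val_inj => /=.
  have [hi _ _ _] := hxs i; have [hj _ _ _] := hxs j.
  have [h|h|//] := ltngtP i j.
    have mij : m i + pi *+ 2 <= m j.
      by rewrite /m -mulrSr; apply: ler_wpMn2l => //; lra.
    by exfalso; rewrite eq_ij in hi; lra.
  have mji : m j + pi *+ 2 <= m i.
    by rewrite /m -mulrSr; apply: ler_wpMn2l => //; lra.
  by exfalso; rewrite eq_ij in hi; lra.
move=> i; have [hi h2 h3 h4] := hxs i; split => //.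
rewrite -(subrK (m i) (xs i)) cosD2pin cos_gt0_pihalf //; lra.
Qed.
End one_variable.

(** * Mean curvature of a level set *)

Section hypersurface_geometry.
Variables (R : realType) (n : nat).
Local Notation V := 'rV[R]_n.

Lemma frechet_partial (f : V -> R) (p : V) : differentiable f p ->
  forall e : R, 0 < e -> \forall q \near p,
    `|f q - f p - \sum_i (q - p) 0 i * partial i f p| <= e * `|q - p|.
Proof.
move=> df e e0.
have /eqaddoP/(_ e e0) := diff_locally df.
rewrite (near_shift 0 p) /prop_near1 /= => h.
apply: filterS h => q /=.
rewrite subr0 addrK; congr (`|_| <= _).
rewrite -[LHS]/(f (q + p) - (f p + 'd f p q)) opprD addrA; congr (_ - _).
rewrite {1}(row_sum_delta q) linear_sum; apply: eq_bigr => i _.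
by rewrite linearZ /= -deriveE.
Qed.

Lemma dotrE (v w : V) : v *m w^T = (dotr v w)%:M.
Proof.
apply/matrixP => i j; rewrite !ord1 !mxE eqxx mulr1n.
by apply: eq_bigr => k _; rewrite mxE.
Qed.

Lemma dotr_ge0 (v : V) : 0 <= dotr v v.
Proof. by apply: sumr_ge0 => i _; rewrite -expr2 sqr_ge0. Qed.

Lemma dotr_eq0 (v : V) : (dotr v v == 0) = (v == 0).
Proof.
apply/eqP/eqP => [|->]; last by apply: big1 => i _; rewrite mxE mul0r.
move=> /eqP; rewrite psumr_eq0 => [/allP h|i _]; last by rewrite -expr2 sqr_ge0.
apply/rowP => i; rewrite mxE; apply/eqP.
by have := h i (mem_index_enum _); rewrite /= -expr2 sqrf_eq0.
Qed.

Lemma dotr_gt0 (v : V) : (0 < dotr v v) = (v != 0).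
Proof. by rewrite lt_def dotr_ge0 andbT dotr_eq0. Qed.

Lemma is_derive_invsqrt (s : R) : 0 < s ->
  is_derive s 1 (fun t => (Num.sqrt t)^-1) (- (2 * Num.sqrt s ^+ 3)^-1).
Proof.
move=> s0; have q0 : 0 < Num.sqrt s by rewrite sqrtr_gt0.
have [d1 d2] := is_derive1_sqrt s0.
split; first by apply: derivableV => //; rewrite gt_eqF.
rewrite deriveV // ?gt_eqF // d2 /GRing.scale /=.
by field; rewrite gt_eqF.
Qed.

Variables (psi : V -> R) (p : V).
Hypothesis dpsi : differentiable psi p.
Hypothesis ddpsi : forall j, differentiable (partial j psi) p.

Let g := gradient psi p.
Let H := hessian psi p.
Let G (q : V) : V := (enorm (gradient psi q))^-1 *: gradient psi q.
Let w := enorm g.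
Hypothesis g0 : g != 0.

Let w_gt0 : 0 < w. Proof. by rewrite sqrtr_gt0 dotr_gt0. Qed.

Let sqr_w : w ^+ 2 = dotr g g. Proof. by rewrite sqr_sqrtr ?dotr_ge0. Qed.

Let normal_sq j : differentiable (fun q => dotr (gradient psi q) (gradient psi q)) p /\
  partial j (fun q => dotr (gradient psi q) (gradient psi q)) p
  = 2 * (H *m g^T) j 0.
Proof.
have eq_ : (fun q => dotr (gradient psi q) (gradient psi q)) =
    \sum_(i < n) (partial i psi * partial i psi).
  apply/funext => q; rewrite fct_sumE /dotr; apply: eq_bigr => i _.
  by rewrite !mxE.
rewrite eq_; split; first by apply: differentiable_sum => i; exact: differentiableM.
rewrite /partial derive_sum; last first.
  by move=> i; apply: derivableM; exact/diff_derivable/ddpsi.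
rewrite mxE mulr_sumr; apply: eq_bigr => i _.
rewrite deriveM; try exact/diff_derivable/ddpsi.
by rewrite /GRing.scale /= !mxE /partial; ring.
Qed.

(** The unit normal is [|g|^-1 g]; since the derivative of [|g|^-1] is
    [- |g|^-3 (H g)], the second term makes the derivative of the normal
    tangential. *)
Lemma normal_derivative j : differentiable (fun q => G q 0 j) p /\
  forall i, partial i (fun q => G q 0 j) p =
    (w^-1 *: H - (w ^- 3) *: (H *m g^T *m g)) i j.
Proof.
have gg0 : 0 < dotr g g by rewrite dotr_gt0.
have eq_ : (fun q => G q 0 j) =
    ((fun t => (Num.sqrt t)^-1) \o (fun q => dotr (gradient psi q) (gradient psi q)))
    * partial j psi.
  by apply/funext => q; rewrite /G !mxE.
have hd i := chain_rule 'e_i (normal_sq i).1 (is_derive_invsqrt gg0).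
rewrite eq_; split.
  by apply: differentiableM => //; exact: (hd j).1.
move=> i; rewrite /partial deriveM; [|exact/diff_derivable/(hd i).1|exact/diff_derivable/ddpsi].
rewrite (hd i).2.
have := (normal_sq i).2; rewrite /partial => ->.
pose K := H *m g^T *m g.
rewrite -/K [RHS]mxE [(w^-1 *: H) i j]mxE [(- (w ^- 3 *: K)) i j]mxE.
rewrite [(w ^- 3 *: K) i j]mxE [K i j]mxE big_ord1 /GRing.scale /= -/(enorm _) -/g -/w.
rewrite [g 0 j]mxE [H i j]mxE /partial.
by field; rewrite gt_eqF.
Qed.

Let J := w^-1 *: H - (w ^- 3) *: (H *m g^T *m g).
Let nu := w^-1 *: g.

Let nu_unit : nu *m nu^T = 1%:M.
Proof.
rewrite /nu [(_ *: _)^T]linearZ /= -scalemxAl -scalemxAr scalerA dotrE -sqr_w.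
by rewrite scale_scalar_mx -expr2 exprVn mulVf // expf_neq0 // gt_eqF.
Qed.

(** Differentiating [|G|^2 = 1] gives [J nu^T = 0]. Hence cutting off the normal
    line, which replaces [J] by [(1 - nu^T nu) J], leaves the trace unchanged. *)
Let J_nu : J *m nu^T = 0.
Proof.
rewrite /J /nu [(_ *: g)^T]linearZ /= -scalemxAr mulmxBl -!scalemxAl -!mulmxA dotrE -sqr_w.
rewrite mul_mx_scalar -!scalemxAr scalerA [_ *: _ - _](_ : _ = 0) ?scaler0 //.
apply/eqP; rewrite subr_eq0; apply/eqP; congr (_ *: _).
by field; rewrite gt_eqF.
Qed.

Let L := J - nu^T *m (nu *m J).

Lemma trace_gauss_differential :
  \tr L = (w ^+ 2 * laplacian psi p - (g *m H *m g^T) 0 0) / w ^+ 3.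
Proof.
have -> : \tr L = \tr J.
  rewrite /L linearB /= mxtrace_mulC -mulmxA J_nu mulmx0 linear0 subr0 //.
rewrite /J linearB /= !linearZ /= mxtrace_mulC mulmxA /laplacian -/H.
rewrite /(\tr (g *m H *m g^T)) big_ord1 /GRing.scale /=.
by field; rewrite gt_eqF.
Qed.

(** For [q] on the boundary, [psi q = psi p = 0], so the normal component of
    [q - p] is [o(|q - p|)], and the differential may be modified at will along
    the normal line. *)
Lemma tangential_gauss_differential Omega :
  (forall q, frontier Omega q -> psi q = 0) -> frontier Omega p ->
  is_gauss_differential Omega G p L.
Proof.
move=> psi0 fp; split; last first.
  rewrite /L mulmxBr [G p *m (_ *m _)]mulmxA /G -/g -/(w) -/nu nu_unit mul1mx.
  by rewrite subrr.
move=> e e0.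
have near_j j : \forall q \near within (frontier Omega) (nbhs p),
    `|(G q - G p - (q - p) *m L) 0 j| <= e * `|q - p|.
  have [dGj pGj] := normal_derivative j.
  pose c := `|(nu *m J) 0 j| + 1.
  have c0 : 0 < c by rewrite ltr_wpDl.
  have e2 : 0 < e / 2 by rewrite divr_gt0.
  have ec : 0 < e * w / (2 * c) by rewrite divr_gt0 ?mulr_gt0.
  have n1 := frechet_partial dGj e2.
  have n2 := frechet_partial dpsi ec.
  near=> q.
  have fq : frontier Omega q by near: q; exact: withinT.
  have q1 : `|G q 0 j - G p 0 j - ((q - p) *m J) 0 j| <= e / 2 * `|q - p|.
    rewrite [((q - p) *m J) 0 j]mxE; under eq_bigr do rewrite -pGj.
    by near: q; apply: cvg_within.
  have q2 : `|((q - p) *m nu^T) 0 0| <= e / (2 * c) * `|q - p|.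
    have : `|psi q - psi p - ((q - p) *m g^T) 0 0| <= e * w / (2 * c) * `|q - p|.
      rewrite [((q - p) *m g^T) 0 0]mxE; under eq_bigr do rewrite [g^T _ _]mxE [g _ _]mxE.
      by near: q; apply: cvg_within.
    rewrite !psi0 // subrr sub0r normrN => h.
    rewrite /nu [(_ *: _)^T]linearZ /= -scalemxAr mxE normrM gtr0_norm ?invr_gt0 //.
    rewrite ler_pdivrMl //; apply: le_trans h _.
    by rewrite le_eqVlt; apply/orP; left; apply/eqP; ring.
  have -> : (G q - G p - (q - p) *m L) 0 j =
     (G q 0 j - G p 0 j - ((q - p) *m J) 0 j) +
     ((q - p) *m nu^T) 0 0 * (nu *m J) 0 j.
    rewrite /L mulmxBr [(q - p) *m (nu^T *m _)]mulmxA.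
    have -> : (q - p) *m nu^T *m (nu *m J) =
      ((q - p) *m nu^T) 0 0 *: (nu *m J).
      by rewrite {1}[(q - p) *m nu^T]mx11_scalar mul_scalar_mx.
    move: (G q) (G p) (_ *m J) (_ *m J) (_ 0 0) => x y A B c'.
    by rewrite !mxE; ring.
  rewrite (le_trans (ler_normD _ _)) //.
  rewrite [e]splitr mulrDl lerD // normrM.
  apply: (@le_trans _ _ (e / (2 * c) * `|q - p| * c)).
    by apply: ler_pM => //; rewrite lerDl.
  rewrite le_eqVlt; apply/orP; left; apply/eqP; field.
  by rewrite gt_eqF.
have : \forall q \near within (frontier Omega) (nbhs p), forall j,
    `|(G q - G p - (q - p) *m L) 0 j| <= e * `|q - p|.
  exact: filter_forall.
apply: filterS => q h.
rewrite [leLHS]/Num.Def.normr /= mx_normrE bigmax_le ?mulr_ge0 // ?ltW //.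
by move=> [i j] _ /=; rewrite ord1; exact: h.
Unshelve. all: by end_near. Qed.
End hypersurface_geometry.

(** The trace of the differential of the Gauss map is the divergence of the
    unit normal field, [(|g|^2 tr H - g H g^T) / |g|^3]. *)
Lemma mean_curvature_gt0 (R : realType) (n : nat) (Omega : set 'rV[R]_n)
    (psi : 'rV[R]_n -> R) (p : 'rV[R]_n) :
  (1 < n)%N ->
  (forall q, frontier Omega q -> local_defining_function Omega q psi) ->
  (forall q, frontier Omega q -> psi q = 0) ->
  differentiable psi p -> (forall j, differentiable (partial j psi) p) ->
  frontier Omega p ->
  0 < dotr (gradient psi p) (gradient psi p) * laplacian psi p -
      (gradient psi p *m hessian psi p *m (gradient psi p)^T) 0 0 ->
  exists2 H, is_mean_curvature Omega p H & 0 < H.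
Proof.
move=> n1 ldf psi0 dpsi ddpsi fp pos.
have g0 : gradient psi p != 0 by have [U [_ Up _ + _]] := ldf p fp; apply.
set G := fun q => (enorm (gradient psi q))^-1 *: gradient psi q.
have trL := trace_gauss_differential g0.
have tgL := tangential_gauss_differential dpsi ddpsi g0 psi0 fp.
move: trL tgL; set L := (X in \tr X) => trL tgL.
exists (n.-1%:R^-1 * \tr L); first exists G, L; first split => //.
  by move=> q fq; exists psi => //; exact: ldf.
have w0 : 0 < enorm (gradient psi p) by rewrite sqrtr_gt0 dotr_gt0.
rewrite trL sqr_sqrtr ?dotr_ge0 // mulr_gt0 ?divr_gt0 ?exprn_gt0 //.
by rewrite invr_gt0 ltr0n -subn1 subn_gt0.
Qed.

(** * Lebesgue measure of thin shells *)

Section lebesgue_shell.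
Variable R : realType.
Local Notation T n := (n.-tuple (measurableTypeR R)).
Local Open Scope ereal_scope.

(** The integral of a nonnegative function is the supremum over the simple
    functions below it, which makes it monotone without any measurability.
    Hence the measure of an arbitrary set can be bounded through its fibers. *)
Lemma le_ge0_integral d (S : measurableType d) (mu : {measure set S -> \bar R})
    (f g : S -> \bar R) :
  (forall x, 0 <= f x) -> (forall x, f x <= g x) ->
  \int[mu]_x f x <= \int[mu]_x g x.
Proof.
move=> f0 fg; have g0 x : 0 <= g x by exact: le_trans (fg x).
rewrite !ge0_integralTE //; apply: ereal_sup_le => _ [h hf <-].
by exists h => // x; exact: le_trans (hf x) (fg x).
Qed.

Lemma lebesgue_tupleS n (A : set (T n.+1)) :
  lebesgue_tuple R n.+1 A =
  \int[lebesgue_tuple R n]_z lebesgue_measure [set t : R | A [tuple of t :: z]].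
Proof.
rewrite /= /pushforward /= /product_measure1.
apply: eq_integral => z _ /=; congr (lebesgue_measure _).
by apply/seteqP; split => t /=; rewrite /xsection /= inE.
Qed.

(** The half of Fubini's theorem that holds for an arbitrary set. *)
Lemma lebesgue_tuple_le_fiber n (A : set (T n.+1)) (B : set (T n)) (c : R) :
  measurable B -> (0 <= c)%R ->
  (forall (t : R) (z : T n), A [tuple of t :: z] -> B z) ->
  (forall z : T n, lebesgue_measure [set t : R | A [tuple of t :: z]] <= c%:E) ->
  lebesgue_tuple R n.+1 A <= c%:E * lebesgue_tuple R n B.
Proof.
move=> mB c0 AB Ac; rewrite lebesgue_tupleS -integral_cst // [leRHS]integral_mkcond.
apply: le_ge0_integral => z; first exact: measure_ge0.
rewrite patchE; case: ifPn => [_|/negP zB]; first exact: Ac.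
rewrite (_ : [set t | _] = set0) ?measure0 //.
by apply/seteqP; split => // t /= /AB zB'; apply: zB; rewrite inE.
Qed.

Definition box n (M : R) : set (T n) := [set z | forall i, (`|tnth z i| <= M)%R].
Arguments box : clear implicits.

Lemma measurable_box n M : measurable (box n M).
Proof.
rewrite (_ : box n M = \bigcap_(i : 'I_n) ((@tnth n _)^~ i @^-1` [set t | `|t| <= M]%R)).
  apply: fin_bigcap_measurable => [|i _]; first exact: finite_finset.
  rewrite -[_ @^-1` _]setTI; apply: measurable_tnth => //.
  rewrite (_ : [set t | _] = `[(-M)%R, M]%classic) //.
  by apply/seteqP; split => t /=; rewrite in_itv /= ler_norml.
by apply/seteqP; split => z /= h i; [move=> _|]; exact: h.
Qed.

Lemma lebesgue_itvcc_le (a b c : R) : (b - a <= c)%R -> (0 <= c)%R ->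
  lebesgue_measure `[a, b]%classic <= c%:E.
Proof.
move=> bac c0; rewrite lebesgue_measure_itv /=.
by case: ifP => _; rewrite ?lee_fin // -EFinB lee_fin.
Qed.

Lemma lebesgue_norm_le (M : R) : (0 <= M)%R ->
  lebesgue_measure [set t : R | `|t| <= M]%R <= (2 * M)%:E.
Proof.
move=> M0; rewrite (_ : [set t | _] = `[(-M)%R, M]%classic).
  by apply: lebesgue_itvcc_le; lra.
by apply/seteqP; split => t /=; rewrite in_itv /= ler_norml.
Qed.

Lemma lebesgue_box_le n M : (0 <= M)%R ->
  lebesgue_tuple R n (box n M) <= ((2 * M) ^+ n)%:E.
Proof.
move=> M0; elim: n => [|n IH].
  by rewrite /= diracE expr0 lee_fin; case: (_ \in _).
rewrite exprS EFinM.
apply: (@le_trans _ _ ((2 * M)%:E * lebesgue_tuple R n (box n M))).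
  apply: lebesgue_tuple_le_fiber => [|/=||z].
  - exact: measurable_box.
  - lra.
  - move=> t z h i; have := h (lift ord0 i).
    by rewrite tnthS.
  - apply: le_trans (lebesgue_norm_le M0); apply: le_mu_ext => t h.
    exact: (h ord0).
by rewrite lee_wpmul2l // lee_fin; lra.
Qed.

(** With [r = sqrt (a + d)], the set lies in the two intervals of length
    [sqrt d] that end at [r] and start at [- r], whatever the sign of [a]. *)
Lemma lebesgue_sqr_itv_le (a d : R) : (0 <= d)%R ->
  lebesgue_measure [set t : R | a <= t ^+ 2 <= a + d]%R <= (2 * Num.sqrt d)%:E.
Proof.
move=> d0; pose r := Num.sqrt (a + d); pose q := Num.sqrt d.
have q0 : (0 <= q)%R by exact: sqrtr_ge0.
have qq : (q ^+ 2 = d)%R by rewrite sqr_sqrtr.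
apply: (@le_trans _ _ (lebesgue_measure
    (`[(r - q)%R, r] `|` `[(- r)%R, (q - r)%R])%classic)).
  apply: le_mu_ext => t /= /andP[t1 t2].
  have ad0 : (0 <= a + d)%R by apply: le_trans t2; exact: sqr_ge0.
  have r0 : (0 <= r)%R by exact: sqrtr_ge0.
  have rr : (r ^+ 2 = a + d)%R by rewrite sqr_sqrtr.
  rewrite !in_itv /=; have [t0|t0] := leP 0%R t; [left|right]; nra.
apply: le_trans (measureU2 _ _ _) _; try exact: measurable_itv.
rewrite -/q mulr_natl mulr2n EFinD leeD // lebesgue_itvcc_le //; lra.
Qed.

Lemma lebesgue_shell_le n (M a d : R) : (0 <= M)%R -> (0 <= d)%R ->
  lebesgue_tuple R n.+1 (box n.+1 M `&`
    [set z | a <= \sum_(i < n.+1) tnth z i ^+ 2 <= a + d]%R)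
  <= (2 * Num.sqrt d * (2 * M) ^+ n)%:E.
Proof.
move=> M0 d0; rewrite EFinM.
apply: (@le_trans _ _ ((2 * Num.sqrt d)%:E * lebesgue_tuple R n (box n M))).
  apply: lebesgue_tuple_le_fiber => [|/=||z].
  - exact: measurable_box.
  - by rewrite mulr_ge0 // sqrtr_ge0.
  - by move=> t z [h _] i; have := h (lift ord0 i); rewrite tnthS.
  - apply: le_trans (lebesgue_sqr_itv_le (a - \sum_(i < n) tnth z i ^+ 2)%R d0).
    apply: le_mu_ext => t [_].
    rewrite [X in X -> _]/mkset big_ord_recl; under eq_bigr do rewrite tnthS.
    by rewrite tnth0 /=; lra.
by rewrite lee_wpmul2l ?lebesgue_box_le // lee_fin mulr_ge0 // sqrtr_ge0.
Qed.

Lemma measurable_shell n (a b : R) :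
  measurable [set z : T n | a <= \sum_(i < n) tnth z i ^+ 2 <= b]%R.
Proof.
have mf : measurable_fun setT (fun z : T n => \sum_(i < n) tnth z i ^+ 2)%R.
  apply: measurable_sum => i; apply: measurable_funX.
  exact: measurable_tnth.
have := mf measurableT _ (@measurable_itv R `[a, b]); rewrite setTI.
congr measurable; apply/seteqP; split => z /=; by rewrite in_itv.
Qed.

(** The axial coordinate contributes a factor [2 M], one transversal coordinate
    the small factor, and the [N] remaining ones a factor [2 M] each. *)
Lemma lebesgue_cylindrical_shell_le N (M d : R) (A : set 'rV[R]_N.+2) :
  (0 <= M)%R -> (0 <= d)%R ->
  (forall v i, A v -> `|v 0%R i| <= M)%R ->
  (forall v, A v -> `|1 - \sum_(i < N.+1) v 0%R (lift ord0 i) ^+ 2| <= d)%R ->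
  lebesgue_rV A <= (2 * M * (2 * Num.sqrt (2 * d) * (2 * M) ^+ N))%:E.
Proof.
move=> M0 d0 AM Ad; rewrite /lebesgue_rV EFinM.
set B := box N.+1 M `&` [set z | 1 - d <= \sum_(i < N.+1) tnth z i ^+ 2 <= 1 - d + 2 * d]%R.
apply: (@le_trans _ _ ((2 * M)%:E * lebesgue_tuple R N.+1 B)).
  apply: lebesgue_tuple_le_fiber => [|/=||z].
  - by apply: measurableI; [exact: measurable_box|exact: measurable_shell].
  - lra.
  - move=> t z h; split.
      by move=> i; have := AM _ (lift ord0 i) h; rewrite mxE tnthS.
    have := Ad _ h; under eq_bigr do rewrite mxE tnthS.
    by rewrite /= ler_norml; lra.
  - apply: le_trans (lebesgue_norm_le M0); apply: le_mu_ext => t h.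
    by have := AM _ ord0 h; rewrite mxE.
by rewrite lee_wpmul2l ?lebesgue_shell_le // ?lee_fin; lra.
Qed.

End lebesgue_shell.

(** * The torsion function and its domain *)

Section neg_expr.
Variables (R : realType) (n : nat).
Implicit Types (t : expr R n) (x : 'rV[R]_n).
Local Notation neg t := (Mul (Cst n (-1)) t).

Lemma partial_neg t j : partial j (eval (neg t)) = eval (neg (der j t)).
Proof. by rewrite partial_eval; apply/funext => x /=; rewrite mul0r add0r. Qed.

Lemma gradient_neg t x : gradient (eval (neg t)) x = - gradient (eval t) x.
Proof.
by apply/rowP => j; rewrite !mxE partial_neg partial_eval /= mulN1r.
Qed.

Lemma hessian_neg t x : hessian (eval (neg t)) x = - hessian (eval t) x.
Proof.
by apply/matrixP => i j; rewrite !mxE !partial_neg !partial_eval /= mulN1r.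
Qed.

End neg_expr.

Lemma sum_delta (R : pzRingType) n (k : 'I_n) (F : 'I_n -> R) :
  \sum_(i < n) F i * (k == i)%:R = F k.
Proof.
rewrite (bigD1 k) //= eqxx mulr1 big1 ?addr0 // => i ik.
by rewrite eq_sym (negbTE ik) mulr0.
Qed.

Lemma quad_form_delta (R : comPzRingType) n (v : 'rV[R]_n) (i j : 'I_n) :
  (v *m delta_mx i j *m v^T) 0 0 = v 0 i * v 0 j.
Proof.
rewrite -(mul_delta_mx (0 : 'I_1)) mulmxA -colE -mulmxA -rowE mxE big_ord1.
by rewrite !mxE.
Qed.

Section torsion_function.
Variables (R : realType) (n : nat) (a b : 'I_n) (kappa beta e : R).
Hypothesis ab : a != b.
Local Notation V := 'rV[R]_n.
Implicit Types p q : V.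

(** Here [a] is the axial coordinate, [b] a transversal one, and [kappa] is to be
    [1 / (2 (n - 1))]. Only the coordinates [a] and [b] occur in the perturbation
    of the torsion function of the cylinder. *)
Definition torsion_expr : expr R n :=
  Add (Mul (Cst n kappa) (Add (Cst n 1) (Mul (Cst n (-1))
         (Sum (fun i => Mul (Cst n (i != a)%:R) (Mul (Var R i) (Var R i)))))))
      (Mul (Cst n (- e)) (Add
         (Mul (Cst n beta)
            (Add (Mul (Var R a) (Var R a)) (Mul (Cst n (-1)) (Mul (Var R b) (Var R b)))))
         (Mul (Cst n (-1)) (Mul (Cos (Var R a)) (Cosh (Var R b)))))).

Definition torsion_fun : V -> R := eval torsion_expr.
Local Notation u := torsion_fun.

Definition radius_sq p : R := \sum_(i < n) (i != a)%:R * p 0 i ^+ 2.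
Local Notation s := radius_sq.

Lemma torsion_funE p : u p = kappa * (1 - s p) -
  e * (beta * (p 0 a ^+ 2 - p 0 b ^+ 2) - cos (p 0 a) * cosh (p 0 b)).
Proof.
rewrite /torsion_fun /= /radius_sq; under eq_bigr do rewrite -expr2.
by ring.
Qed.

Definition gradient_expr (j : 'I_n) : expr R n :=
  Add (Mul (Cst n (- (2 * kappa * (j != a)%:R))) (Var R j))
    (Mul (Cst n (- e)) (Add
      (Mul (Cst n (a == j)%:R)
         (Add (Mul (Cst n (2 * beta)) (Var R a)) (Mul (Sin (Var R a)) (Cosh (Var R b)))))
      (Mul (Cst n (b == j)%:R)
         (Add (Mul (Cst n (- (2 * beta))) (Var R b))
              (Mul (Cst n (-1)) (Mul (Cos (Var R a)) (Sinh (Var R b)))))))).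

Lemma partial_torsion_fun j : partial j u = eval (gradient_expr j).
Proof.
rewrite /torsion_fun partial_eval; apply/funext => p /=.
have -> : \sum_(i < n) (0 * (p 0 i * p 0 i) +
     (i != a)%:R * ((i == j)%:R * p 0 i + p 0 i * (i == j)%:R)) =
   2 * (j != a)%:R * p 0 j.
  rewrite -(sum_delta j (fun i => 2 * (i != a)%:R * p 0 i)).
  by apply: eq_bigr => i _; rewrite [j == i]eq_sym; ring.
by ring.
Qed.

(** Up to the factor [- e], [pert_aa] and [pert_ab] are the second derivatives of
    the perturbation in the plane of [a] and [b]; by harmonicity the remaining
    one is [- pert_aa]. *)
Definition pert_aa p := 2 * beta + cos (p 0 a) * cosh (p 0 b).
Definition pert_ab p := sin (p 0 a) * sinh (p 0 b).

Lemma hessian_torsion_fun p : hessian u p =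
  - (2 * kappa) *: diag_mx (\row_j (j != a)%:R)
  - e *: (pert_aa p *: (delta_mx a a - delta_mx b b) +
          pert_ab p *: (delta_mx a b + delta_mx b a)).
Proof.
apply/matrixP => i j.
rewrite !mxE partial_torsion_fun partial_eval /= /pert_aa /pert_ab -!mulnb !natrM.
rewrite (eq_sym i a) (eq_sym j a) (eq_sym i b) (eq_sym j b) (eq_sym i j).
by case: (eqVneq j i) => [->|_]; rewrite ?mulr1n ?mulr0n; ring.
Qed.

Lemma laplacian_torsion_fun p : 2 * kappa * n.-1%:R = 1 -> laplacian u p = -1.
Proof.
move=> kn; rewrite /laplacian hessian_torsion_fun !(linearB, linearD, linearZ) /=.
have tr_delta (i j : 'I_n) : \tr (delta_mx i j : 'M[R]_n) = (i == j)%:R.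
  rewrite /mxtrace -[RHS](sum_delta i (fun k => (k == j)%:R)).
  by apply: eq_bigr => k _; rewrite mxE -mulnb natrM mulrC [k == i]eq_sym.
rewrite !tr_delta !eqxx (negbTE ab) eq_sym (negbTE ab) mxtrace_diag.
under eq_bigr do rewrite mxE.
have -> : \sum_(i < n) (i != a)%:R = n.-1%:R :> R.
  rewrite (bigID (fun i => i != a)) /= [X in _ + X]big1 ?addr0.
    rewrite (eq_bigr (fun=> 1)) => [|i ->//].
    by rewrite sumr_const cardC1 card_ord.
  by move=> i /negbTE ->.
rewrite -[X in _ = - X]kn /GRing.scale /=; ring.
Qed.

Lemma quad_form_torsion_fun p (v : V) :
  (v *m hessian u p *m v^T) 0 0 =
  - (2 * kappa) * (dotr v v - v 0 a ^+ 2)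
  - e * (pert_aa p * (v 0 a ^+ 2 - v 0 b ^+ 2) + 2 * pert_ab p * (v 0 a * v 0 b)).
Proof.
have add (M N : 'M[R]_n) :
    (v *m (M + N) *m v^T) 0 0 = (v *m M *m v^T) 0 0 + (v *m N *m v^T) 0 0.
  by rewrite mulmxDr mulmxDl mxE.
have scale c (M : 'M[R]_n) : (v *m (c *: M) *m v^T) 0 0 = c * (v *m M *m v^T) 0 0.
  by rewrite -scalemxAr -scalemxAl mxE.
have opp (M : 'M[R]_n) : (v *m (- M) *m v^T) 0 0 = - (v *m M *m v^T) 0 0.
  by rewrite mulmxN mulNmx mxE.
have diag : (v *m diag_mx (\row_j (j != a)%:R) *m v^T) 0 0 = dotr v v - v 0 a ^+ 2.
  rewrite -(sum_delta a (fun i => v 0 i ^+ 2)) /dotr -sumrB mxE.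
  apply: eq_bigr => i _; rewrite mul_mx_diag !mxE (eq_sym a).
  by case: (i == a) => /=; ring.
rewrite hessian_torsion_fun !(add, opp, scale) diag !quad_form_delta.
by ring.
Qed.

(** Up to the constant [kappa] and the trigonometric term, [u] is homogeneous of
    degree 2; this is Euler's identity for it, with the defect. *)
Lemma euler_torsion_fun (p : V) : \sum_(j < n) p 0 j * partial j u p =
  2 * u p - 2 * kappa - e * (2 * (cos (p 0 a) * cosh (p 0 b))
    + p 0 a * (sin (p 0 a) * cosh (p 0 b)) - p 0 b * (cos (p 0 a) * sinh (p 0 b))).
Proof.
have -> : \sum_(j < n) p 0 j * partial j u p = - (2 * kappa) * s p
    - e * (\sum_(j < n) p 0 j * (2 * beta * p 0 a + sin (p 0 a) * cosh (p 0 b)) * (a == j)%:R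
    + \sum_(j < n) p 0 j * (- (2 * beta) * p 0 b - cos (p 0 a) * sinh (p 0 b)) * (b == j)%:R).
  rewrite -big_split /= mulr_sumr mulr_sumr -sumrB; apply: eq_bigr => j _.
  by rewrite partial_torsion_fun /=; ring.
by rewrite !sum_delta torsion_funE; ring.
Qed.

(** The bound on the coordinate [b] discards the region where [cosh] makes [u]
    positive again. *)
Definition torsion_domain : set V := [set p : V | `|p 0 b| < 2 /\ 0 < u p].
Local Notation Omega := torsion_domain.

Let continuous_norm_b : continuous (fun p : V => `|p 0 b|).
Proof.
move=> p; apply: (@continuous_comp _ _ _ (fun q : V => q 0 b) (fun r : R => `|r|)).
  exact: coord_continuous.
exact: norm_continuous.
Qed.

Let open_slab : open [set p : V | `|p 0 b| < 2].
Proof.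
apply: (@open_comp _ _ (fun p : V => `|p 0 b|) [set r | r < 2]) => [p _|].
  exact: continuous_norm_b.
exact: open_lt.
Qed.

Lemma open_torsion_domain : open Omega.
Proof.
apply: openI => //.
apply: (@open_comp _ _ u [set r | 0 < r]) => [p _|].
  exact: continuous_eval.
exact: open_gt.
Qed.

Lemma radius_sq_ge (j : 'I_n) (p : V) : j != a -> p 0 j ^+ 2 <= s p.
Proof.
move=> ja; rewrite /radius_sq (bigD1 j) //= ja mul1r lerDl.
by apply: sumr_ge0 => i _; rewrite mulr_ge0 ?ler0n ?sqr_ge0.
Qed.

Local Notation E := (@expR R 2).
Hypotheses (kappa0 : 0 < kappa) (kappa4 : kappa <= 4^-1).
Hypotheses (kn : 2 * kappa * n.-1%:R = 1).
Hypotheses (beta0 : 0 < beta) (e0 : 0 < e).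
(** The smallness of [e] is used through these two inequalities only. *)
Hypotheses (small1 : 8 * (e * (4 * beta + E)) <= kappa).
Hypotheses (small2 : 32 * (e * E ^+ 2) <= beta * kappa).

Let E_ge1 : 1 <= E. Proof. by have := @expR_ge1Dx R 2; lra. Qed.

Let kappa_ge0 : 0 <= kappa. Proof. exact: ltW. Qed.
Let beta_ge0 : 0 <= beta. Proof. exact: ltW. Qed.
Let e_ge0 : 0 <= e. Proof. exact: ltW. Qed.
Let eb_ge0 : 0 <= e * beta. Proof. exact: mulr_ge0. Qed.

Let axial_term_ge0 p : 0 <= e * (beta * p 0 a ^+ 2).
Proof. by rewrite mulr_ge0 // mulr_ge0 // sqr_ge0. Qed.

Let radial_term_ge0 p : 0 <= kappa * s p.
Proof.
rewrite mulr_ge0 //; apply: sumr_ge0 => i _.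
by rewrite mulr_ge0 ?sqr_ge0 ?ler0n.
Qed.

Let trig_bound (c d M : R) : `|c| <= 1 -> `|d| <= M -> `|c * d| <= M.
Proof. by move=> c1 dM; rewrite normrM -[M]mul1r ler_pM. Qed.

(** The only terms of [u] that can compensate the negative ones are at most
    [e (4 beta + expR 2)] on the slab, hence at most [kappa / 8]. *)
Lemma torsion_domain_bound (p : V) : `|p 0 b| <= 2 -> 0 <= u p ->
  kappa * s p + e * (beta * p 0 a ^+ 2) <= 9 / 8 * kappa.
Proof.
move=> pb; rewrite torsion_funE => up.
have pb2 : p 0 b ^+ 2 <= 4.
  by rewrite -real_normK ?num_real //; have := normr_ge0 (p 0 b); nra.
have : cos (p 0 a) * cosh (p 0 b) <= E.
  apply: le_trans (ler_norm _) _; apply: trig_bound; first exact: cos_max.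
  by rewrite ger0_norm ?cosh_le //; have := cosh_ge1 (p 0 b); lra.
move: up small1; set c := cos _ * _; set X := _ ^+ 2; set Y := _ ^+ 2 => up h1 h2.
have : e * c <= e * E by rewrite ler_wpM2l // ltW.
have : e * beta * Y <= e * beta * 4 by rewrite ler_wpM2l.
by lra.
Qed.

(** The closed slab condition improves to a strict one where [u >= 0]: there
    [|p b|^2 <= s p <= 9 / 8]. This keeps the sides of the slab away from the
    boundary of the domain. *)
Lemma torsion_domain_slab (p : V) : `|p 0 b| <= 2 -> 0 <= u p -> `|p 0 b| < 2.
Proof.
move=> pb up; have := torsion_domain_bound pb up.
have ba : b != a by rewrite eq_sym.
have := radius_sq_ge p ba.
rewrite -real_normK ?num_real //; have := normr_ge0 (p 0 b).
set y := `|_|; have := axial_term_ge0 p => h1 y0 h2 h3; rewrite ltNge; apply/negP => y2.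
have s4 : 4 <= s p.
  by apply: le_trans h2; rewrite expr2 (_ : 4 = 2 * 2) ?ler_pM //; lra.
have : kappa * 4 <= kappa * s p by rewrite ler_wpM2l.
by move: kappa0; lra.
Qed.

(** The axial length of the domain is of order [e^(-1/2)], so [e |x|] is of order
    [e^(1/2)]. *)
Lemma torsion_domain_axial_bound (p : V) : `|p 0 b| <= 2 -> 0 <= u p ->
  e * (E * `|p 0 a|) <= kappa / 4.
Proof.
move=> pb up; have := torsion_domain_bound pb up.
have := radial_term_ge0 p; rewrite -(real_normK (num_real (p 0 a))); set x := `|_| => h1 h2.
have x0 : 0 <= x by exact: normr_ge0.
rewrite leNgt; apply/negP => h3.
have : e * (beta * x ^+ 2) * (32 * (e * E ^+ 2)) <= 9 / 8 * kappa * (beta * kappa).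
  apply: ler_pM => //; last lra.
    by rewrite mulr_ge0 // mulr_ge0 // sqr_ge0.
  by rewrite mulr_ge0 // mulr_ge0 // sqr_ge0.
have : (kappa / 4) ^+ 2 < (e * (E * x)) ^+ 2.
  by rewrite ltr_pXn2r // nnegrE ?divr_ge0 // mulr_ge0 // mulr_ge0 // expR_ge0.
set Z := e * (E * x) => h4 h5.
have : beta * (kappa / 4) ^+ 2 < beta * Z ^+ 2 by rewrite ltr_pM2l.
have : e * (beta * x ^+ 2) * (32 * (e * E ^+ 2)) = 32 * (beta * Z ^+ 2).
  by rewrite /Z; ring.
have : 0 < beta * kappa ^+ 2 by rewrite mulr_gt0 ?exprn_gt0.
by move: h5; lra.
Qed.

(** In [u (t p) - t^2 u p] the quadratic terms cancel. What remains is
    [kappa (1 - t^2)] and the defect of the trigonometric term, which is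
    Lipschitz in [t] with constant of order [1 + |x|]. *)
Lemma torsion_fun_homothety (p : V) (t : R) : 0 <= t <= 1 ->
  `|p 0 b| <= 2 -> 0 <= u p ->
  t ^+ 2 * u p + (1 - t ^+ 2) * (3 / 8 * kappa) <= u (t *: p).
Proof.
move=> /andP[t0 t1] pb up; have ax := torsion_domain_axial_bound pb up.
have st : s (t *: p) = t ^+ 2 * s p.
  by rewrite /radius_sq mulr_sumr; apply: eq_bigr => i _; rewrite mxE; ring.
rewrite !torsion_funE st !mxE.
move: ax pb; set x := p 0 a; set y := p 0 b => ax pb.
have ty : `|t * y| <= 2.
  by rewrite normrM (ger0_norm t0); apply: le_trans pb; exact: ler_piMl.
have t1' : 0 <= 1 - t by rewrite subr_ge0.
have c0 z : 0 <= cosh z :> R by have := cosh_ge1 z; lra.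
have h1 : `|(cos (t * x) - cos x) * cosh (t * y)| <= (1 - t) * `|x| * E.
  rewrite normrM ler_pM // ?(ger0_norm (c0 _)) ?cosh_le //.
  apply: le_trans (cos_lipschitz _ _) _.
  by rewrite -[X in _ - X]mul1r -mulrBl normrM distrC (ger0_norm t1').
have h2 : `|cos x * (cosh (t * y) - cosh y)| <= (1 - t) * 2 * E.
  apply: trig_bound; first exact: cos_max.
  apply: le_trans (cosh_lipschitz ty pb) _.
  rewrite -[X in _ - X]mul1r -mulrBl normrM distrC (ger0_norm t1').
  by rewrite mulrC ler_wpM2r ?expR_ge0 // ler_wpM2l.
have h3 : `|cos x * cosh y| <= E.
  by apply: trig_bound; [exact: cos_max|rewrite (ger0_norm (c0 _)) cosh_le].
move: h1 h2 h3; rewrite !ler_norml => /andP[h1 _] /andP[h2 _] /andP[h3 _].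
have t2 : 0 <= 1 - t ^+ 2 by nra.
have tt : 1 - t <= 1 - t ^+ 2 by nra.
have xE : 0 <= `|x| * E by rewrite mulr_ge0 // expR_ge0.
have h4 : (1 - t) * `|x| * E <= (1 - t ^+ 2) * (`|x| * E).
  by rewrite -mulrA ler_wpM2r.
have h5 : (1 - t) * 2 * E <= (1 - t ^+ 2) * (2 * E).
  by rewrite -mulrA ler_wpM2r // mulr_ge0 // expR_ge0.
have h6 : (1 - t ^+ 2) * - E <= (1 - t ^+ 2) * (cos x * cosh y) by rewrite ler_wpM2l.
have h7 : - ((1 - t ^+ 2) * (`|x| * E + 3 * E)) <=
    cos (t * x) * cosh (t * y) - t ^+ 2 * (cos x * cosh y).
  by move: h1 h2 h4 h5 h6; lra.
have h8 : e * - ((1 - t ^+ 2) * (`|x| * E + 3 * E)) <=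
    e * (cos (t * x) * cosh (t * y) - t ^+ 2 * (cos x * cosh y)).
  by rewrite ler_wpM2l // ltW.
have h9 : (1 - t ^+ 2) * (e * (`|x| * E + 3 * E)) <=
    (1 - t ^+ 2) * (5 / 8 * kappa).
  rewrite ler_wpM2l //.
  by move: small1 ax eb_ge0; lra.
by move: h8 h9; lra.
Qed.

Lemma torsion_fun0 : 0 < u 0.
Proof.
have s0 : s 0 = 0 by apply: big1 => i _; rewrite mxE; ring.
rewrite torsion_funE s0 !mxE cos0 mul1r; have c1 := cosh_ge1 (0 : R).
by have := mulr_ge0 e_ge0 (le_trans ler01 c1); move: kappa0; lra.
Qed.

Lemma origin_in_torsion_domain : Omega 0.
Proof. by split; rewrite ?mxE ?normr0 //; exact: torsion_fun0. Qed.

Lemma starshaped_torsion_domain p (t : R) : Omega p -> 0 <= t <= 1 -> Omega (t *: p).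
Proof.
move=> [pb up] t01; split.
  have /andP[t0 t1] := t01; rewrite mxE normrM (ger0_norm t0).
  by have := normr_ge0 (p 0 b); nra.
have := torsion_fun_homothety t01 (ltW pb) (ltW up); apply: lt_le_trans.
have /andP[t0 t1] := t01.
have [->|tn0] := eqVneq t 0.
  by rewrite expr0n /= mul0r add0r subr0 mul1r; move: kappa0; lra.
rewrite ltr_wpDr //.
  by rewrite mulr_ge0 ?subr_ge0 ?exprn_ile1 //; move: kappa0; lra.
by rewrite mulr_gt0 // exprn_gt0 // lt_def tn0.
Qed.

(** The domain is the union of the segments joining its points to the origin. *)
Lemma connected_torsion_domain : connected Omega.
Proof.
have -> : Omega = \bigcup_(p in Omega) ((fun t : R => t *: p) @` `[0, 1]).
  apply/seteqP; split => [p Op|_ [p Op [t /= t01 <-]]].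
    by exists p => //; exists 1; [rewrite /= in_itv /= ler01 lexx|exact: scale1r].
  by apply: starshaped_torsion_domain; rewrite in_itv in t01.
apply: bigcup_connected.
  by exists 0 => p _; exists 0; [rewrite /= in_itv /= lexx ler01|exact: scale0r].
move=> p _; apply: connected_continuous_connected.
  exact: segment_connected.
apply: continuous_subspaceT => t; exact: scalel_continuous.
Qed.

Lemma bounded_torsion_domain : bounded_set Omega.
Proof.
pose M : R := 2 + 9 / 8 * kappa / (e * beta).
have eb : 0 < e * beta by rewrite mulr_gt0.
have M2 : 2 <= M by rewrite lerDl divr_ge0 ?(ltW eb) //; move: kappa0; lra.
exists M; split => [|r Mr p [pb up]]; first exact: num_real.
apply: le_trans (ltW Mr).
rewrite [leLHS]/Num.Def.normr /= mx_normrE bigmax_le ?(le_trans _ M2) //.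
move=> [i j] _ /=; rewrite ord1.
have := torsion_domain_bound (ltW pb) (ltW up).
have sq_le (z : R) : z ^+ 2 <= M ^+ 2 -> `|z| <= M.
  by rewrite -[z ^+ 2]real_normK ?num_real // ler_pXn2r ?nnegrE //; lra.
have [->|ja] := eqVneq j a => h.
  apply: sq_le; have := radial_term_ge0 p => h2; apply: (@le_trans _ _ (9 / 8 * kappa / (e * beta))).
    by rewrite ler_pdivlMr //; lra.
  apply: (@le_trans _ _ M); first by rewrite lerDr.
  by rewrite expr2 ler_peMl //; lra.
apply: sq_le; apply: le_trans (radius_sq_ge p ja) _.
have := axial_term_ge0 p => h2; have : kappa * s p <= kappa * 4 by move: kappa0; lra.
rewrite ler_pM2l // => h3; apply: le_trans h3 _.
by rewrite expr2 (_ : 4 = 2 * 2) ?ler_pM //; lra.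
Qed.

Lemma frontier_torsion_domain p : frontier Omega p -> `|p 0 b| < 2 /\ u p = 0.
Proof.
move=> [cl nint].
have [pb up] : `|p 0 b| <= 2 /\ 0 <= u p.
  suff : closure Omega `<=` [set q : V | `|q 0 b| <= 2] `&` [set q : V | 0 <= u q] by apply.
  have cb : closed [set q : V | `|q 0 b| <= 2].
    apply: (@closed_comp _ _ (fun q : V => `|q 0 b|) [set r | r <= 2]) => [q _|].
      exact: continuous_norm_b.
    exact: closed_le.
  have cu : closed [set q : V | 0 <= u q].
    apply: (@closed_comp _ _ u [set r | 0 <= r]) => [q _|].
      exact: continuous_eval.
    exact: closed_ge.
  rewrite closureE => q; apply; split; first exact: closedI.
  by move=> z [zb uz]; split; exact: ltW.
have pb2 := torsion_domain_slab pb up; split => //.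
apply/eqP; rewrite eq_le up andbT leNgt; apply/negP => up'.
apply: nint; apply: open_nbhs_nbhs; split; first exact: open_torsion_domain.
by split.
Qed.

(** The radial derivative is [2 u - 2 kappa] up to a small error, hence negative
    where [u = 0]. *)
Lemma gradient_torsion_fun_neq0 p : `|p 0 b| <= 2 -> u p = 0 -> gradient u p != 0.
Proof.
move=> pb up; apply/eqP => g0.
have := euler_torsion_fun p; rewrite big1; last first.
  by move=> j _; move/rowP/(_ j) : g0; rewrite !mxE => ->; rewrite mulr0.
have ax : e * (E * `|p 0 a|) <= kappa / 4.
  by apply: torsion_domain_axial_bound => //; rewrite up.
have c0 : 0 <= cosh (p 0 b) by have := cosh_ge1 (p 0 b); lra.
have h1 : `|cos (p 0 a) * cosh (p 0 b)| <= E.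
  by apply: trig_bound; [exact: cos_max|rewrite (ger0_norm c0) cosh_le].
have h2 : `|p 0 a * (sin (p 0 a) * cosh (p 0 b))| <= E * `|p 0 a|.
  rewrite normrM mulrC ler_wpM2r //.
  by apply: trig_bound; [exact: sin_max|rewrite (ger0_norm c0) cosh_le].
have h3 : `|p 0 b * (cos (p 0 a) * sinh (p 0 b))| <= 2 * E.
  rewrite normrM ler_pM //.
  by apply: trig_bound; [exact: cos_max|rewrite sinh_le].
move: h1 h2 h3; rewrite up !ler_norml => /andP[h1 _] /andP[h2 _] /andP[_ h3].
have h : - (E * `|p 0 a| + 4 * E) <= 2 * (cos (p 0 a) * cosh (p 0 b)) +
    p 0 a * (sin (p 0 a) * cosh (p 0 b)) - p 0 b * (cos (p 0 a) * sinh (p 0 b)).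
  by lra.
have := ler_wpM2l (ltW e0) h.
have := eb_ge0.
by move: small1 ax kappa0; lra.
Qed.

Definition defining_expr : expr R n := Mul (Cst n (-1)) torsion_expr.
Local Notation psi := (eval defining_expr).

Lemma defining_exprE p : psi p = - u p.
Proof. by rewrite /= mulN1r. Qed.

Lemma torsion_domain_defining_function p : frontier Omega p ->
  local_defining_function Omega p psi.
Proof.
move=> /frontier_torsion_domain[pb up].
exists ([set q : V | `|q 0 b| < 2] `&` [set q | gradient psi q != 0]); split.
- apply: openI => //.
  pose t := Sum (fun j => Mul (der j defining_expr) (der j defining_expr)).
  have tE q : eval t q = dotr (gradient psi q) (gradient psi q).
    by rewrite [LHS]/=; apply: eq_bigr => j _; rewrite !mxE partial_eval.
  have -> : [set q | gradient psi q != 0] = eval t @^-1` [set r | 0 < r].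
    by apply/seteqP; split=> q; rewrite /preimage /mkset tE dotr_gt0.
  by apply: open_comp => [q _|]; [exact: continuous_eval|exact: open_gt].
- split; first exact: pb.
  rewrite /mkset gradient_neg oppr_eq0.
  by apply: gradient_torsion_fun_neq0; rewrite ?ltW.
- exact: smooth_eval.
- by move=> q [].
- by move=> q [qb _]; rewrite defining_exprE oppr_lt0; split=> [[]|uq]; last split.
Qed.

Lemma smooth_torsion_domain : smooth_domain Omega.
Proof.
split; [exact: open_torsion_domain| |exact: connected_torsion_domain|].
  by exists 0; exact: origin_in_torsion_domain.
by move=> p fp; exists psi; exact: torsion_domain_defining_function.
Qed.

(** The quadratic form of the Hessian is at least [- 2 kappa - small] times
    [|g|^2], and [2 kappa <= 1 / 2] because the hypersurface has dimension at
    least 2. *)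
Lemma torsion_domain_mean_curvature p : (2 < n)%N -> frontier Omega p ->
  exists2 H, is_mean_curvature Omega p H & 0 < H.
Proof.
move=> n2 fp; have [pb up] := frontier_torsion_domain fp.
apply: (@mean_curvature_gt0 _ _ _ psi) => //.
- exact: ltnW.
- by move=> q; exact: torsion_domain_defining_function.
- by move=> q /frontier_torsion_domain[_ uq]; rewrite defining_exprE uq oppr0.
- exact: differentiable_eval.
- by move=> j; rewrite partial_eval; exact: differentiable_eval.
rewrite /laplacian hessian_neg gradient_neg -/u linearN /= -/(laplacian u p).
rewrite laplacian_torsion_fun // opprK mulr1.
set g := gradient u p.
have -> : (- g *m - hessian u p *m (- g)^T) 0 0 = - (g *m hessian u p *m g^T) 0 0.
  by rewrite [(- g)^T]linearN /= !(mulmxN, mulNmx) opprK mxE.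
have -> : dotr (- g) (- g) = dotr g g.
  by apply: eq_bigr => i _; rewrite !mxE mulrNN.
rewrite opprK quad_form_torsion_fun.
have gg : 0 < dotr g g.
  by rewrite dotr_gt0; apply: gradient_torsion_fun_neq0; rewrite ?ltW.
have gab : g 0 a ^+ 2 + g 0 b ^+ 2 <= dotr g g.
  rewrite /dotr (bigD1 a) //= (bigD1 b) 1?eq_sym //= -!expr2 addrA lerDl.
  by apply: sumr_ge0 => i _; rewrite -expr2 sqr_ge0.
have c0 : 0 <= cosh (p 0 b) by have := cosh_ge1 (p 0 b); lra.
have hW : `|pert_aa p| <= 2 * beta + E.
  rewrite (le_trans (ler_normD _ _)) // lerD //.
    by rewrite ger0_norm //; move: beta0; lra.
  apply: trig_bound; first exact: cos_max.
  by rewrite (ger0_norm c0) cosh_le // ltW.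
have hS : `|pert_ab p| <= E.
  by apply: trig_bound; [exact: sin_max|rewrite sinh_le // ltW].
have h1 : `|pert_aa p * (g 0 a ^+ 2 - g 0 b ^+ 2)| <= (2 * beta + E) * dotr g g.
  rewrite normrM ler_pM // ler_norml; have := sqr_ge0 (g 0 a).
  by have := sqr_ge0 (g 0 b); lra.
have h2 : `|pert_ab p * (2 * (g 0 a * g 0 b))| <= E * dotr g g.
  rewrite normrM ler_pM // ler_norml; have := sqr_ge0 (g 0 a - g 0 b).
  by have := sqr_ge0 (g 0 a + g 0 b); lra.
move: h1 h2; rewrite !ler_norml => /andP[_ h1] /andP[_ h2].
have h3 : e * (pert_aa p * (g 0 a ^+ 2 - g 0 b ^+ 2) + pert_ab p * (2 * (g 0 a * g 0 b))) <=
   e * ((2 * beta + E) * dotr g g + E * dotr g g).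
  by rewrite ler_wpM2l ?lerD // ltW.
have h4 : e * ((2 * beta + E) + E) * dotr g g <= kappa / 4 * dotr g g.
  rewrite ler_wpM2r ?(ltW gg) //; have := eb_ge0.
  by move: small1 kappa0 beta0; lra.
have h5 : kappa * dotr g g <= 4^-1 * dotr g g by rewrite ler_wpM2r ?(ltW gg).
have h6 : 0 <= kappa * g 0 a ^+ 2 by rewrite mulr_ge0 ?sqr_ge0 // ltW.
by move: h3 h4 h5 h6 gg kappa0; lra.
Qed.

Lemma torsion_solution_torsion_fun : torsion_solution Omega u.
Proof.
split=> [|p _|p /frontier_torsion_domain[]//].
  exact/continuous_subspaceT/continuous_eval.
by rewrite laplacian_torsion_fun // opprK.
Qed.

(** A nondegenerate well of the axial profile [beta x^2 - cos x] gives a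
    nondegenerate maximum of [u] on the axis. *)
Section axial_maximum.
Variable x : R.
Hypotheses (cosx : 0 < cos x) (crit : 2 * beta * x + sin x = 0).
Hypothesis well_neg : beta * x ^+ 2 - cos x < 0.
Hypothesis well_min : \forall z \near x,
  beta * x ^+ 2 - cos x <= beta * z ^+ 2 - cos z.

Definition axial_point : V := x *: 'e_a.
Local Notation P := axial_point.

Let Pa : P 0 a = x. Proof. by rewrite !mxE !eqxx mulr1. Qed.
Let Pj j : j != a -> P 0 j = 0.
Proof. by rewrite !mxE => /negbTE ->; rewrite andbF mulr0. Qed.
Let ba : b != a. Proof. by rewrite eq_sym. Qed.
Let cosh0 : cosh 0 = 1 :> R. Proof. by rewrite /cosh oppr0 expR0; lra. Qed.
Let sinh0 : sinh 0 = 0 :> R. Proof. by rewrite /sinh oppr0 subrr mul0r. Qed.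

Let uP : u P = kappa - e * (beta * x ^+ 2 - cos x).
Proof.
have sP : s P = 0.
  apply: big1 => i _; case: (eqVneq i a) => [_|/Pj ->]; first by rewrite mul0r.
  by rewrite expr0n mulr0.
by rewrite torsion_funE sP Pa Pj // cosh0; ring.
Qed.

Lemma axial_point_in_torsion_domain : Omega P.
Proof.
split; first by rewrite Pj // normr0.
have h : 0 < cos x - beta * x ^+ 2 by move: well_neg; lra.
by rewrite uP; have := mulr_gt0 e0 h; move: kappa0; lra.
Qed.

(** Along the axis the well is a minimum of the profile; moving off the axis
    costs [kappa s], which beats the gain [e (beta + expR 2) y^2] coming from
    [beta y^2] and from [cos x (cosh y - 1)]. *)
Lemma is_local_max_axial_point : is_local_max u P.
Proof.
have cvg_coord j : (fun p : V => p 0 j) @ P --> P 0 j.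
  exact: coord_continuous.
have near_a : \forall p \near P,
    beta * x ^+ 2 - cos x <= beta * (p : V) 0 a ^+ 2 - cos (p 0 a).
  have near_z : \forall z \near P 0 a,
      beta * x ^+ 2 - cos x <= beta * z ^+ 2 - cos z by rewrite Pa.
  exact: (cvg_coord a _ near_z).
have near_b : \forall p \near P, (p : V) 0 b \in `]-2, 2[.
  have near_y : \forall y \near P 0 b, y \in `]-2, 2[.
    by apply: near_in_itvoo; rewrite Pj // in_itv /=; lra.
  exact: (cvg_coord b _ near_y).
near=> p.
have ha : beta * x ^+ 2 - cos x <= beta * p 0 a ^+ 2 - cos (p 0 a) by near: p.
have : p 0 b \in `]-2, 2[ by near: p.
rewrite in_itv /= => /andP[hb1 hb2].
have pb : `|p 0 b| <= 2 by rewrite ler_norml; lra.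
have h1 : cos (p 0 a) * (cosh (p 0 b) - 1) <= E * p 0 b ^+ 2.
  apply: le_trans (cosh_sub1_le pb).
  by rewrite ler_piMl ?cos_le1 // subr_ge0 cosh_ge1.
rewrite uP torsion_funE.
have h2 : e * (beta * x ^+ 2 - cos x) <= e * (beta * p 0 a ^+ 2 - cos (p 0 a)).
  by rewrite ler_wpM2l // ltW.
have h3 : e * (cos (p 0 a) * (cosh (p 0 b) - 1)) <= e * (E * p 0 b ^+ 2).
  by rewrite ler_wpM2l // ltW.
have h4 : kappa * p 0 b ^+ 2 <= kappa * s p.
  by rewrite ler_wpM2l ?radius_sq_ge // ltW.
have h5 : e * (beta + E) * p 0 b ^+ 2 <= kappa * p 0 b ^+ 2.
  rewrite ler_wpM2r ?sqr_ge0 //.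
  have := eb_ge0.
  have : 0 <= e * E by rewrite mulr_ge0 ?expR_ge0 // ltW.
  by move: small1 kappa0 beta0; lra.
by move: h2 h3 h4 h5; lra.
Unshelve. all: by end_near. Qed.

(** On the axis the mixed derivative vanishes with [sinh 0], so the Hessian is
    diagonal. *)
Lemma nondegenerate_axial_point : nondegenerate_critical_point u P.
Proof.
split.
  apply/rowP => j; rewrite [LHS]mxE [RHS]mxE partial_torsion_fun /=.
  rewrite Pa (Pj ba) cosh0 sinh0.
  case: (eqVneq j a) => [->|ja]; last by rewrite Pj //=; ring.
  by rewrite (negbTE ba) /= mulr1 crit; ring.
have S0 : pert_ab P = 0 by rewrite /pert_ab (Pj ba) sinh0 mulr0.
have WP : pert_aa P = 2 * beta + cos x by rewrite /pert_aa Pa (Pj ba) cosh0 mulr1.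
have -> : hessian u P = diag_mx (\row_j (- (2 * kappa) * (j != a)%:R
    - e * (pert_aa P * ((j == a)%:R - (j == b)%:R)))).
  rewrite hessian_torsion_fun S0 scale0r addr0; apply/matrixP => i j.
  rewrite !mxE -!mulnb !natrM.
  case: (eqVneq i j) => [->|ij]; first by rewrite !mulr1n -!natrM !mulnb !andbb; ring.
  have off k : (i == k)%:R * (j == k)%:R = 0 :> R.
    by case: (eqVneq i k) => [<-|_]; rewrite ?mul0r // eq_sym (negbTE ij) mulr0.
  by rewrite !off !mulr0n; ring.
have W0 : 0 < pert_aa P by rewrite WP; move: beta0 cosx; lra.
have eW : e * pert_aa P <= kappa.
  have : e * pert_aa P <= e * (2 * beta + 1).
    by rewrite ler_wpM2l ?(ltW e0) // WP lerD2l cos_le1.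
  have := eb_ge0.
  have : e <= e * E by rewrite ler_peMr.
  by move: small1 kappa0 beta0; lra.
have eW0 : 0 < e * pert_aa P by rewrite mulr_gt0.
rewrite unitmxE det_diag unitfE prodf_seq_neq0; apply/allP => j _ /=.
rewrite mxE; case: (eqVneq j a) => [->|_] /=.
  by rewrite (negbTE ab) /= mulr0 subr0 mulr1 sub0r oppr_eq0 gt_eqF.
by rewrite lt_eqF //; move: eW eW0 kappa0; case: (j == b) => /=; lra.
Qed.
End axial_maximum.

(** In the symmetric difference, [kappa (1 - s)] and [u] have opposite signs, so
    [kappa |1 - s|] is at most their difference, the perturbation. *)
Lemma torsion_domain_near_cylinder (M : R) (p : V) :
  0 <= M -> (forall j, `|p 0 j| <= M) ->
  ([set q | s q < 1] `+` Omega) p ->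
  `|1 - s p| <= (beta * M ^+ 2 + expR M) / kappa * e.
Proof.
move=> M0 pM; rewrite mulrAC ler_pdivlMr //.
have sq_le j : p 0 j ^+ 2 <= M ^+ 2.
  by rewrite -real_normK ?num_real // ler_pXn2r ?nnegrE.
have h1 : `|cos (p 0 a) * cosh (p 0 b)| <= expR M.
  apply: trig_bound; first exact: cos_max.
  by rewrite ger0_norm ?cosh_le //; have := cosh_ge1 (p 0 b); lra.
have h2 : `|beta * (p 0 a ^+ 2 - p 0 b ^+ 2) - cos (p 0 a) * cosh (p 0 b)| <=
    beta * M ^+ 2 + expR M.
  rewrite (le_trans (ler_normB _ _)) // lerD // normrM gtr0_norm // ler_wpM2l ?(ltW beta0) //.
  have := sq_le a; have := sq_le b; have := sqr_ge0 (p 0 a); have := sqr_ge0 (p 0 b).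
  by rewrite ler_norml; lra.
have h3 := ler_wpM2l (ltW e0) h2; move: h3.
rewrite -[X in X * `|_|](gtr0_norm e0) -normrM ler_norml => h3.
move=> [[/= s1 nO]|[/= [pb up] /negP s1]].
  have up : u p <= 0.
    rewrite leNgt; apply/negP => up; apply: nO; split => //.
    rewrite -ltr_sqr ?nnegrE // real_normK ?num_real //.
    by apply: le_lt_trans (radius_sq_ge p _) _; rewrite 1?eq_sym //; lra.
  rewrite ger0_norm ?subr_ge0 ?(ltW s1) //.
  by move: up h3; rewrite torsion_funE; lra.
rewrite ler0_norm; last by rewrite subr_le0 leNgt.
by move: up h3; rewrite torsion_funE; lra.
Qed.

End torsion_function.

(** * The family of domains *)

Lemma near_small (R : realType) (c d : R) : 0 < d ->
  \forall e \near 0^'+, e * c <= d.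
Proof.
move=> d0; have : \forall e \near (0 : R), e * c < d.
  have h : (fun e : R => e * c) @ (0 : R) --> (0 * c : R).
    exact: mulrr_continuous.
  by rewrite mul0r in h; exact: (h _ (lt_nbhsl d0)).
move=> h; near=> e; apply: ltW; near: e; exact: cvg_within h.
Unshelve. all: by end_near. Qed.

Lemma radius_sq_ord0 (R : realType) N (q : 'rV[R]_N.+1) :
  radius_sq ord0 q = \sum_(i < N) q 0 (lift ord0 i) ^+ 2.
Proof.
rewrite /radius_sq big_ord_recl eqxx mul0r add0r.
by apply: eq_bigr => i _; rewrite mul1r.
Qed.

Theorem theorem1p2 (R : realType) (N : nat) (hN : (2 <= N)%N) (k : nat) :
  exists (Omega : R -> set 'rV[R]_N.+1) (u : R -> 'rV[R]_N.+1 -> R),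
    (\forall e \near 0^'+,
      (smooth_domain (Omega e) /\ bounded_set (Omega e)) /\
      (smooth_on (Omega e) (u e) /\ forall x, Omega e x -> 0 < u e x) /\
      starshaped_interior (Omega e) /\
      (forall p, frontier (Omega e) p ->
         exists2 H, is_mean_curvature (Omega e) p H & 0 < H) /\
      torsion_solution (Omega e) (u e) /\
      (exists P : 'I_k -> 'rV[R]_N.+1, injective P /\
         forall i, [/\ Omega e (P i), is_local_max (u e) (P i) &
                      nondegenerate_critical_point (u e) (P i)])) /\
    (forall K : set 'rV[R]_N.+1, compact K ->
       lebesgue_rV (K `&` (cylinder R N `+` Omega e)) @[e --> 0^'+] --> 0%E).
Proof.
case: N hN => [|[|n]] // _.
set N := n.+2.
pose a : 'I_N.+1 := ord0; pose b : 'I_N.+1 := lift ord0 ord0.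
have ab : a != b by [].
have [beta beta0 [xs xs_inj wells]] := tilted_cosine_wells R k.
pose kappa : R := (2 * N%:R)^-1.
have N2 : 2 <= N%:R :> R by rewrite ler_nat.
have kappa0 : 0 < kappa by rewrite invr_gt0; lra.
have kn : 2 * kappa * N.+1.-1%:R = 1.
  by rewrite mulrAC /= divff // gt_eqF //; lra.
have kappa4 : kappa <= 4^-1 by rewrite lef_pV2 ?posrE; lra.
have near0 (Q : R -> Prop) :
    (forall e, 0 < e -> 8 * (e * (4 * beta + expR 2)) <= kappa ->
       32 * (e * expR 2 ^+ 2) <= beta * kappa -> Q e) ->
    \forall e \near 0^'+, Q e.
  move=> hQ; near=> e; apply: hQ.
  - by near: e; exact: nbhs_right_gt.
  - have : e * (8 * (4 * beta + expR 2)) <= kappa by near: e; exact: near_small.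
    by lra.
  - have : e * (32 * expR 2 ^+ 2) <= beta * kappa.
      by near: e; apply: near_small; rewrite mulr_gt0.
    by lra.
exists (torsion_domain a b kappa beta), (torsion_fun a b kappa beta); split.
  apply: near0 => e e0 small1 small2; split; first split.
  - exact: smooth_torsion_domain.
  - exact: bounded_torsion_domain.
  split; first by split; [exact: smooth_eval|move=> x []].
  split.
    exists 0.
      by apply: open_nbhs_nbhs; split; [exact: open_torsion_domain|exact: origin_in_torsion_domain].
    by move=> q t qO t01; rewrite add0r subr0; exact: starshaped_torsion_domain.
  split; first by move=> p; exact: torsion_domain_mean_curvature.
  split; first exact: torsion_solution_torsion_fun.
  exists (fun i => axial_point a (xs i)); split.
    move=> i j /rowP/(_ a); rewrite !mxE !eqxx !mulr1; exact: xs_inj.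
  move=> i; have [cosx crit neg_ min_] := wells i; split.
  - exact: axial_point_in_torsion_domain.
  - exact: is_local_max_axial_point.
  - exact: nondegenerate_axial_point.
move=> K /compact_bounded[M0 [_ KM0]].
pose M := `|M0| + 1.
have M0' : 0 <= M by rewrite addr_ge0.
have KM p j : K p -> `|p 0 j| <= M.
  move=> Kp; have : `|p| <= M.
    by apply: KM0 => //; rewrite ltr_pwDr // ler_norm.
  apply: le_trans; rewrite [leRHS]/Num.Def.normr /= mx_normrE.
  exact: (le_bigmax _ _ (0, j)).
pose C := (beta * M ^+ 2 + expR M) / kappa.
have C0 : 0 <= C.
  by rewrite divr_ge0 ?(ltW kappa0) // addr_ge0 ?expR_ge0 // mulr_ge0 ?sqr_ge0 // ltW.
have cylE : cylinder R N = [set q | radius_sq a q < 1].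
  by apply/seteqP; split => q; rewrite /cylinder /mkset radius_sq_ord0.
pose F (e : R) := 2 * M * (2 * Num.sqrt (2 * (C * e)) * (2 * M) ^+ n.+1).
apply: (@squeeze_cvge _ _ _ _ (cst 0%E) _ (fun e => (F e)%:E)).
- apply: near0 => e e0 small1 small2; rewrite measure_ge0 /=.
  apply: lebesgue_cylindrical_shell_le => //.
  + by rewrite mulr_ge0 // ltW.
  + by move=> v i [Kv _]; exact: KM.
  + move=> v [Kv]; rewrite cylE => vO; rewrite -radius_sq_ord0.
    by apply: torsion_domain_near_cylinder vO => // j; exact: KM.
- exact: cvg_cst.
- have -> : 0%E = (F 0)%:E by rewrite /F mulr0 mulr0 sqrtr0 mulr0 mul0r mulr0.
  apply: cvg_EFin; first by near=> e.
  apply: cvg_at_right_filter.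
  rewrite /F; apply: cvgM; first exact: cvg_cst.
  apply: cvgM; last exact: cvg_cst.
  apply: cvgM; first exact: cvg_cst.
  apply: (@continuous_comp _ _ _ (fun e : R => 2 * (C * e)) Num.sqrt).
    apply: cvgM; first exact: cvg_cst.
    by apply: cvgM; [exact: cvg_cst|exact: cvg_id].
  exact: sqrt_continuous.
Unshelve. all: by end_near. Qed.
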